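(* For every integer $k\ge0$, every $h>0$ and every $\varepsilon>0$, $$\inf_{\hat\nu}\ \sup_{\mu_\bullet\in\mathcal C_k(\varepsilon)}\ W_2(\hat\nu,\mu_{t_n+h})\ \ge\ \frac{\varepsilon\,h^{k+1}}{(k+1)!},$$ where the infimum is over all forecasters, i.e. all measurable maps $\hat\nu=\hat\nu(\mu|_{[0,t_n]})\in\mathcal P_2(\mathbb R^d)$ of the exactly observed past of the curve.
   Context: $\mathcal P_2(\mathbb R^d)$: Borel probability measures on $\mathbb R^d$ with finite second moment, with the 2-Wasserstein distance $W_2$ and its Otto--Benamou--Brenier formal Riemannian structure. A curve $t\mapsto\mu_t$ is observed exactly on $[0,t_n]$ and $\mu_{t_n+h}$ is to be forecast. An absolutely continuous curve has velocity field $v_t=\dot\mu_t$ with $\partial_t\mu_t+\nabla\cdot(\mu_tv_t)=0$; $\nabla_t$ is the covariant derivative of vector fields along the curve (Gigli's second-order calculus, requisite tangent-module regularity assumed), and $\|\cdot\|_{\mu_t}$ is the $L^2(\mu_t)$ norm. $\mathcal C_k(\varepsilon)$ is the class of absolutely continuous curves in $\mathcal P_2(\mathbb R^d)$ whose velocity field admits covariant derivatives up to order $k$ with $\operatorname{ess\,sup}_t\|\nabla_t^kv_t\|_{\mu_t}\le\varepsilon$. *)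

(* Defs.v *)
From HB Require Import structures.
From mathcomp Require Import all_boot all_order all_algebra.
From mathcomp Require Import all_classical all_reals all_analysis.
From mathcomp Require Import ess_sup_inf.
Set Implicit Arguments.
Unset Strict Implicit.
Unset Printing Implicit Defensive.
Import Order.TTheory GRing.Theory Num.Theory.
Import numFieldNormedType.Exports.
Local Open Scope classical_set_scope.
Local Open Scope ring_scope.

(* R^d is 'rV[R]_d with its Borel sigma-algebra. The library norm `|x| on
   'rV[R]_d is the sup norm: it is used only through the topology (and the
   derivatives), the metric quantities being built on enorm. *)
HB.instance Definition _ (R : realType) (d : nat) :=
  Measurable.copy 'rV[R]_d (g_sigma_algebraType (@open 'rV[R]_d)).

Section Euclidean.
Context {R : realType} {d : nat}.
Implicit Types (x y : 'rV[R]_d) (phi : 'rV[R]_d -> R).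

Definition dotp x y : R := \sum_(i < d) x 0 i * y 0 i.

Definition enorm x : R := Num.sqrt (dotp x x).

(* forall n, Cn n phi says that all the iterated directional derivatives of phi
   exist and are continuous, i.e. that phi is C^oo. *)
Fixpoint Cn (n : nat) phi : Prop :=
  match n with
  | 0%N => continuous phi
  | m.+1 => forall v, (forall x, derivable phi x v) /\ Cn m (fun x => 'D_v phi x)
  end.

Definition test_function phi : Prop :=
  (forall n, Cn n phi) /\ compact (closure [set x | phi x != 0]).

Definition grad phi x : 'rV[R]_d := \row_i 'D_(delta_mx 0 i) phi x.

End Euclidean.

Record P2 (R : realType) (d : nat) := MkP2 {
  P2_measure :> probability 'rV[R]_d R ;
  P2_moment : (\int[P2_measure]_x (enorm x ^+ 2)%:E < +oo)%E }.

Section Wasserstein.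
Context {R : realType} {d : nat}.
Implicit Types (mu nu : P2 R d) (U : set (P2 R d)).

Definition coupling mu nu (pi : probability ('rV[R]_d * 'rV[R]_d)%type R) :=
  forall A : set 'rV[R]_d, measurable A ->
    pi (A `*` setT) = mu A /\ pi (setT `*` A) = nu A.

Definition W2 mu nu : \bar R :=
  sqrte (ereal_inf
    [set (\int[pi]_z (enorm (z.1 - z.2) ^+ 2)%:E)%E | pi in coupling mu nu]).

Definition W2_open U :=
  forall mu, U mu -> exists2 r : R, 0 < r &
    forall nu, (W2 mu nu < r%:E)%E -> U nu.

Definition P2_borel : set (set (P2 R d)) := <<s W2_open >>.

Definition supp mu : set 'rV[R]_d :=
  [set x | forall V, open_nbhs x V -> (0 < mu V)%E].

Implicit Types (u w xi : 'rV[R]_d -> 'rV[R]_d).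

Definition L2norm mu u : \bar R := ('N[mu]_2%:E [EFin \o (enorm \o u)])%E.

Definition in_L2 mu u := measurable_fun setT u /\ (L2norm mu u < +oo)%E.

Definition tangent mu u :=
  in_L2 mu u /\ forall r : R, 0 < r ->
    exists2 phi, test_function phi &
      (L2norm mu (fun x => u x - grad phi x)%R < r%:E)%E.

Definition tangent_projection mu u w :=
  tangent mu w /\
  forall xi, tangent mu xi -> \int[mu]_x dotp (u x - w x) (xi x) = 0.

End Wasserstein.

Section Curves.
Context {R : realType} {d : nat}.
Local Notation leb := (@lebesgue_measure R).
Variable T : R.
(* Curves and vector fields along them are functions of t in R, of which only
   the restriction to [0, T] matters. *)
Implicit Types (mu : R -> P2 R d) (u v w z : R -> 'rV[R]_d -> 'rV[R]_d).
Implicit Types (Phi : R -> R -> 'rV[R]_d -> 'rV[R]_d).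

Definition abs_cont (dist : R -> R -> \bar R) :=
  exists g : R -> R, leb.-integrable `[0, T] (EFin \o g) /\
    forall s t, 0 <= s -> s <= t -> t <= T ->
      (dist s t <= \int[leb]_(r in `[s, t]) (g r)%:E)%E.

Definition ac_curve mu := abs_cont (fun s t => W2 (mu s) (mu t)).

Definition borel_field u :=
  measurable_fun setT (fun p : R * 'rV[R]_d => u p.1 p.2).

(* Weak form of d_t mu + div (mu v) = 0. *)
Definition continuity_equation mu v :=
  forall phi, test_function phi ->
  forall s t, 0 <= s -> s <= t -> t <= T ->
    \int[mu t]_x phi x - \int[mu s]_x phi x =
    \int[leb]_(r in `[s, t]) (\int[mu r]_x dotp (grad phi x) (v r x)).

(* Among the solutions of the continuity equation, the velocity field is the
   one which is tangent at almost every time. *)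
Definition velocity mu v :=
  [/\ borel_field v,
      (\int[leb]_(t in `[0%R, T]) L2norm (mu t) (v t) < +oo)%E,
      {ae leb, forall t, t \in `[0, T] -> tangent (mu t) (v t)} &
      continuity_equation mu v].

(* The regularity under which Gigli's covariant derivative is defined. *)
Definition regular_curve mu v :=
  (\int[leb]_(t in `[0%R, T]) (L2norm (mu t) (v t) ^+ 2) < +oo)%E /\
  exists ell : R -> R, leb.-integrable `[0, T] (EFin \o ell) /\
    {ae leb, forall t, t \in `[0, T] ->
      forall x y, supp (mu t) x -> supp (mu t) y ->
        enorm (v t x - v t y) <= ell t * enorm (x - y)}.

(* Phi t s : supp (mu t) -> supp (mu s), with d/ds Phi t s x = v_s (Phi t s x)
   for a.e. s and Phi t t x = x; the ODE is written in integral form, coordinate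
   by coordinate. *)
Definition flow mu v Phi :=
  forall t, 0 <= t <= T ->
  [/\ forall x, supp (mu t) x -> Phi t t x = x,
      forall s x, 0 <= s <= T -> supp (mu t) x -> supp (mu s) (Phi t s x),
      forall s, 0 <= s <= T -> measurable_fun setT (Phi t s) &
      forall x s1 s2 i, supp (mu t) x -> 0 <= s1 -> s1 <= s2 -> s2 <= T ->
        leb.-integrable `[s1, s2] (fun r => (v r (Phi t r x) 0 i)%:E) /\
        Phi t s2 x 0 i - Phi t s1 x 0 i =
          \int[leb]_(r in `[s1, s2]) v r (Phi t r x) 0 i].

(* u is absolutely continuous along mu: so is t |-> u_t o Phi t0 t in
   L^2(mu t0), for every t0. *)
Definition ac_field mu Phi u :=
  [/\ borel_field u,
      forall t, 0 <= t <= T -> (L2norm (mu t) (u t) < +oo)%E &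
      forall t0, 0 <= t0 <= T ->
        abs_cont (fun s t =>
          L2norm (mu t0) (fun x => u t (Phi t0 t x) - u s (Phi t0 s x)))].

Definition total_derivative mu Phi u t (z : 'rV[R]_d -> 'rV[R]_d) :=
  in_L2 (mu t) z /\
  L2norm (mu t)
    (fun x => s^-1 *: (u (t + s) (Phi t (t + s) x) - u t x) - z x)
    @[s --> (0 : R)^'] --> (0 : \bar R)%E.

(* w = nabla_t u: the total derivative of u projected on the tangent space. *)
Definition covariant_derivative mu v u w :=
  regular_curve mu v /\
  exists Phi z,
  [/\ flow mu v Phi,
      ac_field mu Phi u,
      {ae leb, forall t, t \in `[0, T] -> tangent (mu t) (u t)},
      borel_field w &
      {ae leb, forall t, t \in `[0, T] ->
        total_derivative mu Phi u t (z t) /\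
        tangent_projection (mu t) (z t) (w t)}].

(* w j is nabla_t^j v. For k = 0 there is no covariant derivative to take and
   the curve is not required to be regular. Extending by 0 outside [0, T] does
   not change the comparison of the essential supremum with eps >= 0. *)
Definition Ck (k : nat) (eps : R) : set (R -> P2 R d) :=
  [set mu | ac_curve mu /\
    exists w : nat -> R -> 'rV[R]_d -> 'rV[R]_d,
    [/\ velocity mu (w 0%N),
        forall j, (j < k)%N -> covariant_derivative mu (w 0%N) (w j) (w j.+1) &
        (ess_sup leb ((fun t => L2norm (mu t) (w k t)) \_ `[0%R, T])
           <= eps%:E)%E]].

End Curves.

Section Forecasting.
Context {R : realType} {d : nat}.
Variable tn : R.

Definition observed : Type := {t : R | 0 <= t <= tn} -> P2 R d.

Definition past (mu : R -> P2 R d) : observed := fun s => mu (sval s).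

Definition cylinder : set (set observed) :=
  [set A | exists s B, P2_borel B /\ A = [set gam | B (gam s)]].

(* Cylinder sigma-algebra on the pasts. On continuous pasts it is the Borel
   sigma-algebra of uniform convergence, (P2, W2) being separable. *)
Definition forecaster (nu : observed -> P2 R d) :=
  forall B, P2_borel B -> <<s cylinder >> (nu @^-1` B).

End Forecasting.

Arguments past {R d} tn mu.
Arguments forecaster {R d} tn nu.

(* Main.v *)
(** Two curves agree up to time [tn] and are as far apart as the class allows at
    time [tn + h]: the Dirac masses at [± a(t) e], with [e] a unit vector,
    [a(t) = 0] for [t <= tn] and [a(t) = eps (t - tn)^(k+1) / (k+1)!] afterwards.
    Their velocity [± a'(t)] and its covariant derivatives are constant in space;
    the [k]-th one has norm at most [eps]. The past, hence the forecast [nu], is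
    the same for both curves. Since [W2(nu, delta_y)^2] is the integral of
    [|x - y|^2] against [nu], the parallelogram identity shows that [nu] lies at
    distance at least [a(tn + h)] from one of the two measures
    [delta_(± a(tn + h) e)]. *)
Require Import Defs.
From HB Require Import structures.
From mathcomp Require Import all_boot all_order all_algebra.
From mathcomp Require Import all_classical all_reals all_analysis.
From mathcomp Require Import measurable_realfun ess_sup_inf ring lra.
Import Order.TTheory GRing.Theory Num.Theory.
Import numFieldNormedType.Exports.
Local Open Scope classical_set_scope.
Local Open Scope ring_scope.

(** * Smooth functions with compact support *)

Section Flat.
Context {R : realType}.
Implicit Types (n : nat) (t : R).

(* The derivative of each [flat n] is a combination of [flat n.+1] and
   [flat n.+2], and [flat n t = O(t ^+ m)] at [0] for every [m]. *)
Definition flat n t : R := if 0 < t then t^-1 ^+ n * expR (- t^-1) else 0.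

Lemma flatS n t : flat n t = t * flat n.+1 t.
Proof.
rewrite /flat; case: ifPn => [t0|]; last by rewrite mulr0.
by rewrite exprS !mulrA divff ?mul1r// gt_eqF.
Qed.

(** With [s = t^-1], the exponential series dominates each of its terms: [s ^+ n / n! <= expR s]. *)
Lemma flat_le n t : `|flat n t| <= n`!%:R.
Proof.
rewrite /flat; case: ifPn => [t0|]; last by rewrite normr0 ler0n.
rewrite ger0_norm ?mulr_ge0 ?expR_ge0 ?exprn_ge0 ?invr_ge0 ?(ltW t0)//.
rewrite expRN ler_pdivrMr ?expR_gt0// mulrC -ler_pdivrMr ?ltr0n ?fact_gt0//.
case: n => [|n].
  rewrite expr0 divr1 (le_trans _ (expR_ge1Dx _))// lerDl invr_ge0 ltW//.
apply: le_trans (expR_ge1Dxn n _); last by rewrite invr_ge0 ltW.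
by rewrite lerDr.
Qed.

Lemma is_derive_flat n t :
  is_derive t 1 (flat n) (flat n.+2 t - n%:R * flat n.+1 t).
Proof.
have [t0|t0|->] := ltgtP t 0.
- apply: (@near_eq_is_derive _ _ _ (cst 0)).
    near=> s; rewrite /flat ifF//; apply/negbTE; rewrite -leNgt ltW//.
    by near: s; exact: lt_nbhsl.
  by rewrite /flat !ifF ?(le_gtF (ltW t0))// mulr0 subrr; exact: is_derive_cst.
- apply: (@near_eq_is_derive _ _ _ (fun s : R => s^-1 ^+ n * expR (- s^-1) : R)).
    near=> s; rewrite /flat ifT//.
    by near: s; exact: lt_nbhsr.
  have tn0 : t != 0 by rewrite gt_eqF.
  have dV : is_derive t 1 (fun s : R => s^-1) (- t ^- 2).
    by have := is_deriveV tn0 (is_derive_id t 1); rewrite /GRing.scale/= mulr1.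
  have dE : is_derive t 1 (expR \o (fun s : R => - s^-1))
      (expR (- t^-1) * - (- t ^- 2)).
    exact: is_derive1_comp.
  have dX := @is_deriveX _ _ (fun s : R => s^-1) n t 1 _ dV.
  have := is_deriveM dX dE; rewrite mulrfctE exprfctE /comp /= => dXE.
  apply: is_derive_eq.
  clear dX dXE; rewrite /flat t0 /GRing.scale/=.
  case: n => [|n]; rewrite ?expr0/=; first by field.
  by rewrite /= !exprVn !exprS; field; rewrite tn0 expf_neq0.
- have flat0 m : flat m 0 = 0 by rewrite /flat ltxx.
  rewrite !flat0 mulr0 subrr.
  suff H : h^-1 *: (flat n (h *: 1 + 0) - flat n 0) @[h --> 0^'] --> (0 : R).
    by apply: DeriveDef; [apply/cvg_ex; exists 0|exact: cvg_lim].
  apply/cvgrPdist_le => e e0; near=> h.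
  rewrite flat0 subr0 addr0 sub0r normrN /GRing.scale/= mulr1.
  have h0 : h != 0 by near: h; exact: nbhs_dnbhs_neq.
  (* Two factors [h] are extracted from [flat n h]: one cancels [h^-1], the other leaves a quotient
     of size at most [h] times [(n.+2)!]. *)
  rewrite flatS mulKf// flatS normrM.
  rewrite (le_trans (ler_wpM2l _ (flat_le _ _)))//.
  rewrite -ler_pdivlMr ?ltr0n ?fact_gt0//.
  by near: h; apply: dnbhs0_le; rewrite divr_gt0 ?ltr0n ?fact_gt0.
Unshelve. all: by end_near. Qed.
End Flat.

(** * Smooth functions, and test functions with a prescribed gradient at a point *)

Section Smooth.
Context {R : realType} {d : nat}.
Local Notation V := 'rV[R]_d.
Implicit Types (f g phi : V -> R) (x v c : V).

(* A class of differentiable functions closed under directional derivatives: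
   all its members are C^oo. *)
Inductive smooth : (V -> R) -> Prop :=
| smooth_cst (a : R) : smooth (fun=> a)
| smooth_coord (i : 'I_d) : smooth (fun x => x 0 i)
| smoothD f g : smooth f -> smooth g -> smooth (fun x => f x + g x)
| smoothM f g : smooth f -> smooth g -> smooth (fun x => f x * g x)
| smooth_flat (n : nat) f : smooth f -> smooth (fun x => flat n (f x)).

Lemma smooth_sum (I : Type) (r : seq I) (F : I -> V -> R) :
  (forall i, smooth (F i)) -> smooth (fun x => \sum_(i <- r) F i x).
Proof.
move=> sF; elim: r => [|i r IH].
  by under eq_fun do rewrite big_nil; exact: smooth_cst.
by under eq_fun do rewrite big_cons; exact: smoothD.
Qed.

(** Total differentials are used because composition with [flat n] calls for the chain rule. The
    class is stable since the derivative of [flat n] combines [flat n.+1] and [flat n.+2]. *)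
Lemma smooth_is_diff f : smooth f -> exists Df : V -> V -> R,
  (forall x, is_diff x f (Df x)) /\ forall v, smooth (Df^~ v).
Proof.
elim=> {f} [a|i|f g _ [Df [dDf sDf]] _ [Dg [dDg sDg]]
           |f g sf [Df [dDf sDf]] sg [Dg [dDg sDg]]|n f sf [Df [dDf sDf]]].
- exists (fun=> 0); split=> [x|v]; last exact: smooth_cst.
  exact: is_diff_cst.
- exists (fun=> fun v => v 0 i); split=> [x|v]; last exact: smooth_cst.
  have @f : {linear V -> R}.
    by exists (fun N : V => N 0 i); do 2![eexists]; do ?[constructor];
       rewrite ?mxE// => ? *; rewrite ?mxE//; move=> ?; rewrite !mxE.
  have cf : continuous f by exact: coord_continuous.
  rewrite (_ : (fun v : V => v 0 i) = f)//.
  by apply: DiffDef; [exact: linear_differentiable|rewrite diff_lin].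
- exists (fun x => Df x + Dg x); split=> [x|v]; last exact: smoothD.
  exact: is_diffD.
- exists (fun x => f x *: Dg x + g x *: Df x); split=> [x|v].
    exact: is_diffM.
  by apply: smoothD; apply: smoothM.
- exists (fun x v => (flat n.+2 (f x) - n%:R * flat n.+1 (f x)) * Df x v).
  split=> [x|v].
    have dn := is_derive_flat n (f x).
    have dfl : is_diff (f x) (flat n)
        (fun h => h *: (flat n.+2 (f x) - n%:R * flat n.+1 (f x))).
      have D : differentiable (flat n) (f x).
        exact/derivable1_diffP/ex_derive.
      by apply: DiffDef => //; rewrite diff1E// derive1E derive_val.
    rewrite [X in is_diff _ _ X](_ : _ = ( *:%R^~
        (flat n.+2 (f x) - n%:R * flat n.+1 (f x))) \o Df x).
      exact: is_diff_comp (dDf x) dfl.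
    by apply/funext => v; rewrite /= /GRing.scale/= mulrC.
  apply: smoothM => //; apply: smoothD; first exact: smooth_flat.
  under eq_fun do rewrite -mulNr.
  by apply: smoothM; [exact: smooth_cst|exact: smooth_flat].
Qed.

Lemma smooth_continuous f : smooth f -> continuous f.
Proof.
move=> /smooth_is_diff[Df [dDf _]] x.
by apply: differentiable_continuous; have [] := dDf x.
Qed.

Lemma smooth_derive f v : smooth f ->
  (forall x, derivable f x v) /\ smooth (fun x => 'D_v f x).
Proof.
move=> /smooth_is_diff[Df [dDf sDf]]; split=> [x|].
  by apply: diff_derivable; have [] := dDf x.
rewrite (_ : (fun x => 'D_v f x) = Df^~ v)//.
by apply/funext => x; have [df <-] := dDf x; rewrite deriveE.
Qed.

Lemma smooth_Cn f n : smooth f -> Cn n f.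
Proof.
elim: n f => [|n IH] f sf /=; first exact: smooth_continuous.
by move=> v; have [] := @smooth_derive f v sf; split=> //; exact: IH.
Qed.

(** The classical bump [exp (- 1 / (1 - |x - x0|^2))], extended by 0 outside the open Euclidean unit
    ball around [x0]. *)
Definition bump x0 x : R :=
  flat 0 (1 - \sum_i (x 0 i - x0 0 i) * (x 0 i - x0 0 i)).

(* [expR 1] makes the factor in front of the linear form equal to 1 at [x0]. *)
Definition bump_linear x0 c x : R :=
  expR 1 * bump x0 x * \sum_i c 0 i * (x 0 i - x0 0 i).

Lemma smooth_bump x0 : smooth (bump x0).
Proof.
have sB i : smooth (fun x => x 0 i - x0 0 i).
  by apply: smoothD; [exact: smooth_coord|exact: smooth_cst].
apply: smooth_flat; apply: smoothD; first exact: smooth_cst.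
under eq_fun do rewrite -mulN1r.
apply: smoothM; first exact: smooth_cst.
by apply: smooth_sum => i; exact: smoothM.
Qed.

Lemma smooth_bump_linear x0 c : smooth (bump_linear x0 c).
Proof.
apply: smoothM.
  by apply: smoothM; [exact: smooth_cst|exact: smooth_bump].
apply: smooth_sum => i; apply: smoothM; first exact: smooth_cst.
by apply: smoothD; [exact: smooth_coord|exact: smooth_cst].
Qed.

Lemma test_function_bump_linear x0 c : test_function (bump_linear x0 c).
Proof.
split=> [n|]; first exact/smooth_Cn/smooth_bump_linear.
(* This compact cube contains the Euclidean unit ball around [x0], outside which the bump vanishes:
   each squared coordinate is at most the whole sum. *)
pose K := [set x : V | forall i, `[x0 0 i - 1, x0 0 i + 1]%classic (x ord0 i)].
have cK : compact K.
  apply: (@rV_compact R d (fun i => `[x0 0 i - 1, x0 0 i + 1]%classic)) => i.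
  exact: segment_compact.
have KE : K = closure K.
  apply/closure_id; apply: compact_closed => //.
apply: (subclosed_compact _ cK); first exact: closed_closure.
rewrite KE; apply: closureS => x /= fx0 i.
have : 0 < 1 - \sum_i (x 0 i - x0 0 i) * (x 0 i - x0 0 i).
  move: fx0; rewrite /bump_linear /bump /flat; case: ifPn => //.
  by rewrite mulr0 mul0r eqxx.
rewrite subr_gt0 (bigD1 i)//= => s1.
have : (x 0 i - x0 0 i) * (x 0 i - x0 0 i) <= 1.
  apply: le_trans (ltW s1); rewrite lerDl sumr_ge0// => j _.
  by rewrite -expr2 sqr_ge0.
rewrite in_itv/= -expr2 => H; apply/andP; split; nra.
Qed.

(** The linear factor vanishes at [x0], so the difference quotient in the [i]-th direction is the
    cutoff at the shifted point times [c 0 i]. Continuity of the cutoff, normalised to 1 at [x0],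
    then gives the limit. *)
Lemma grad_bump_linear x0 c : grad (bump_linear x0 c) x0 = c.
Proof.
apply/rowP => i; rewrite mxE; apply: cvg_lim => //=.
have b0 : expR 1 * bump x0 x0 = 1.
  rewrite /bump big1 => [|j _]; last by rewrite subrr mul0r.
  by rewrite subr0 /flat ltr01 expr0 mul1r invr1 -expRD subrr expR0.
have cvgb : bump x0 (h *: delta_mx 0 i + x0) @[h --> (0 : R)^'] --> bump x0 x0.
  apply: cvg_within_filter.
  apply: (@continuous_cvg _ _ _ _ _ (fun h : R => h *: delta_mx 0 i + x0)).
    by apply: smooth_continuous; exact: smooth_bump.
  rewrite -[X in _ --> X]add0r -(scale0r (delta_mx 0 i)).
  exact: (cvgD (cvgZr_tmp (cvg_id)) (cvg_cst _)).
have {cvgb} : expR 1 * bump x0 (h *: delta_mx 0 i + x0) * c 0 i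
    @[h --> (0 : R)^'] --> c 0 i.
  rewrite -[X in _ --> X](_ : expR 1 * bump x0 x0 * c 0 i = _); last first.
    by rewrite b0 mul1r.
  exact: (cvgM (cvgM (cvg_cst _) cvgb) (cvg_cst _)).
apply: cvg_trans; apply: near_eq_cvg; near=> h.
have h0 : h != 0 by near: h; exact: nbhs_dnbhs_neq.
rewrite /bump_linear [X in _ = _ *: (_ - _ * X)]big1 => [|j _]; last first.
  by rewrite subrr mulr0.
rewrite mulr0 subr0 (bigD1 i)//= big1 => [|j ji]; last first.
  by rewrite !mxE eqxx (negbTE ji) mulr0 add0r subrr mulr0.
rewrite !mxE !eqxx addrK mulr1 addr0 /GRing.scale/=.
by field.
Unshelve. all: by end_near. Qed.

End Smooth.

(** * Dirac masses in the Wasserstein space *)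

Section Measurability.
Context {R : realType} {d : nat}.
Local Notation V := 'rV[R]_d.

Lemma continuous_measurable_from_rV (f : V -> R) :
  continuous f -> measurable_fun setT f.
Proof.
move=> /continuousP cf; apply: (measurability _ (RGenOpens.measurableE R)).
move=> _ [_ [a [b ->] <-]]; rewrite setTI.
by apply: sub_sigma_algebra; exact/cf/interval_open.
Qed.

Lemma continuous_measurable_rV (f : V -> V) :
  continuous f -> measurable_fun setT f.
Proof.
move=> /continuousP cf; apply: (measurability (@open V) erefl).
by move=> _ [A oA <-]; rewrite setTI; apply: sub_sigma_algebra; exact: cf.
Qed.

Lemma continuous_measurable_to_rV (f : R -> V) :
  continuous f -> measurable_fun setT f.
Proof.
move=> /continuousP cf; apply: (measurability (@open V) erefl).
by move=> _ [A oA <-]; rewrite setTI; apply: open_measurable; exact: cf.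
Qed.

Lemma measurable_coord (i : 'I_d) : measurable_fun setT (fun x : V => x 0 i).
Proof. by apply: continuous_measurable_from_rV; exact: coord_continuous. Qed.

(** Measurability is asked coordinate by coordinate, so that differences of vector-valued maps
    reduce to differences of real functions. *)
Lemma measurable_enorm d' (T : measurableType d') (f : T -> V) :
  (forall i, measurable_fun setT (fun x => f x 0 i)) ->
  measurable_fun setT (fun x => enorm (f x)).
Proof.
move=> mf; apply: (@measurableT_comp _ _ _ _ _ _ (@Num.sqrt R)).
  by apply: continuous_measurable_fun; exact: sqrt_continuous.
by apply: measurable_sum => i; exact: measurable_funM.
Qed.

End Measurability.

(** * Euclidean norm and parallelogram identity *)

Section Euclidean_norm.
Context {R : realType} {d : nat}.
Implicit Types x y : 'rV[R]_d.

Lemma dotp_ge0 x : 0 <= dotp x x.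
Proof. by apply: sumr_ge0 => i _; rewrite -expr2 sqr_ge0. Qed.

Lemma enorm_sqr x : enorm x ^+ 2 = dotp x x.
Proof. by rewrite sqr_sqrtr ?dotp_ge0. Qed.

Lemma dotp_delta x (c : R) (i : 'I_d) : dotp x (c *: delta_mx 0 i) = c * x 0 i.
Proof.
rewrite /dotp (bigD1 i)//= big1 => [|j ji].
  by rewrite !mxE !eqxx mulr1 addr0 mulrC.
by rewrite !mxE eqxx (negbTE ji) !mulr0.
Qed.

Lemma enorm_delta (c : R) (i : 'I_d) : enorm (c *: delta_mx 0 i) = `|c|.
Proof.
by rewrite /enorm dotp_delta !mxE !eqxx mulr1 -expr2 sqrtr_sqr.
Qed.

Lemma enorm0 : enorm (0 : 'rV[R]_d) = 0.
Proof. by rewrite /enorm /dotp big1 ?sqrtr0// => i _; rewrite mxE mul0r. Qed.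

Lemma parallelogram x y :
  enorm (x - y) ^+ 2 + enorm (x - - y) ^+ 2 = (enorm x ^+ 2 + enorm y ^+ 2) *+ 2.
Proof.
rewrite !enorm_sqr /dotp -!big_split -sumrMnl/=; apply: eq_bigr => i _.
by rewrite !mxE; ring.
Qed.

End Euclidean_norm.

(** * Integrals, norms and Wasserstein distances at Dirac masses *)

Section Dirac.
Context {R : realType} {d : nat}.
Local Notation V := 'rV[R]_d.
Implicit Types (a b x : V) (nu : P2 R d).

Lemma integral_dirac_rV a (f : V -> R) : measurable_fun setT f ->
  (\int[\d_a]_x (f x)%:E)%E = (f a)%:E.
Proof.
move=> mf; rewrite integral_dirac// ?diracT ?mul1e//.
exact/measurable_EFinP.
Qed.

Lemma measurable_enorm_sqr : measurable_fun setT (fun x : V => enorm x ^+ 2).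
Proof.
apply: measurable_funX; apply: measurable_enorm => i; exact: measurable_coord.
Qed.

Lemma dirac_moment a : (\int[\d_a]_x (enorm x ^+ 2)%:E < +oo)%E.
Proof.
by rewrite integral_dirac_rV ?ltry//; exact: measurable_enorm_sqr.
Qed.

Definition diracP a : P2 R d := @MkP2 R d (dirac a) (dirac_moment a).

Lemma L2norm_dirac a (u : V -> V) :
  (forall i, measurable_fun setT (fun x => u x 0 i)) ->
  L2norm (diracP a) u = (enorm (u a))%:E.
Proof.
move=> mu; rewrite /L2norm unlock /=.
under eq_integral do rewrite /= ger0_norm ?sqrtr_ge0//.
rewrite (@integral_dirac_rV a (fun x => enorm (u x) `^ 2)); last first.
  apply: (measurableT_comp (measurable_powR 2)); exact: measurable_enorm.
by rewrite poweR_EFin -powRrM divff// powRr1// sqrtr_ge0.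
Qed.

Lemma measurable_rVB d' (T : measurableType d') (f g : T -> V) :
  measurable_fun setT f -> measurable_fun setT g ->
  measurable_fun setT (fun t => enorm (f t - g t) ^+ 2).
Proof.
move=> mf mg; apply: measurable_funX; apply: measurable_enorm => i.
under eq_fun do rewrite !mxE.
by apply: measurable_funB; apply: (measurableT_comp (measurable_coord i)).
Qed.

(** The Dirac mass at [(a, b)] is a coupling whose cost is the squared distance. *)
Lemma W2_dirac_le a b : (W2 (diracP a) (diracP b) <= (enorm (a - b))%:E)%E.
Proof.
rewrite -[enorm _]ger0_norm ?sqrtr_ge0// -sqrtr_sqr.
rewrite [X in (_ <= X)%E](_ : _ = sqrte (enorm (a - b) ^+ 2)%:E)//.
rewrite lee_sqrt ?lee_fin ?sqr_ge0//.
apply: ereal_inf_lbound; exists (dirac (a, b)).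
  move=> A mA /=; rewrite !diracE !in_setX !in_setT andbT; split=> //.
rewrite integral_dirac// ?diracT ?mul1e//.
apply/measurable_EFinP; apply: measurable_rVB.
  exact: measurable_fst.
exact: measurable_snd.
Qed.

(** Any coupling with a Dirac mass at [a] is concentrated on the pairs with second component [a], so
    its cost is the integral of [|x - a|^2] against the first marginal. *)
Lemma W2_dirac_ge nu a :
  (sqrte (\int[nu]_x (enorm (x - a) ^+ 2)%:E) <= W2 nu (diracP a))%E.
Proof.
have int_ge0 (p : probability (V * V)%type R) :
    (0 <= \int[p]_z (enorm (z.1 - z.2) ^+ 2)%:E)%E.
  by apply: integral_ge0 => z _; rewrite lee_fin sqr_ge0.
rewrite lee_sqrt; last by apply/ereal_infP => _ [p _ <-].
apply/ereal_infP => _ [p cp <-].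
have ma : measurable [set a].
  rewrite -[X in measurable X]setCK; apply: measurableC.
  apply: sub_sigma_algebra; apply: closed_openC.
  by apply: compact_closed; [exact: norm_hausdorff|exact: compact_set1].
have mf1 : measurable_fun setT (fun x : V => (enorm (x - a) ^+ 2)%:E).
  apply/measurable_EFinP; apply: measurable_rVB; first exact: measurable_id.
  exact: measurable_cst.
have -> : (\int[nu]_x (enorm (x - a) ^+ 2)%:E =
           \int[p]_z (enorm (z.1 - a) ^+ 2)%:E)%E.
  transitivity (\int[pushforward p (@fst V V)]_x (enorm (x - a) ^+ 2)%:E)%E.
    apply: eq_measure_integral => A mA _.
    rewrite /= /pushforward; have [<- _] := cp A mA; congr (p _).
    by apply/seteqP; split=> [[x y] []|[x y]].
  rewrite ge0_integral_pushforward//.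
  by move=> x _; rewrite lee_fin sqr_ge0.
rewrite le_eqVlt; apply/orP; left; apply/eqP; apply: ae_eq_integral => //.
- by apply: (measurableT_comp mf1); exact: measurable_fst.
- apply/measurable_EFinP; apply: measurable_rVB.
    exact: measurable_fst.
  exact: measurable_snd.
(* The exceptional set, where the second component differs from [a], is null because the second
   marginal is the Dirac mass. *)
- exists (setT `*` ~` [set a]); split.
  + by apply: measurableX => //; exact: measurableC.
  + have [_ pa] := cp (~` [set a]) (measurableC ma).
    by apply: (eq_trans pa); rewrite /= diracE memNset//=; apply.
  + by move=> [x y] /= H; split=> // ya; apply: H; rewrite ya.
Qed.

End Dirac.

(** * Tangent fields and supports at Dirac masses; distance to two opposite ones *)

Section Dirac_tangent.
Context {R : realType} {d : nat}.
Local Notation V := 'rV[R]_d.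
Implicit Types (a c x y : V) (nu : P2 R d).

Lemma L2norm_dirac_cst a c : L2norm (diracP a) (fun=> c) = (enorm c)%:E.
Proof. by rewrite L2norm_dirac// => i; exact: measurable_cst. Qed.

(** The norm at a Dirac mass sees only the value at [a], where [bump_linear a c] has gradient
    exactly [c]: the approximation error is 0. *)
Lemma tangent_dirac_cst a c : tangent (diracP a) (fun=> c).
Proof.
split=> [|r r0].
  by split; [exact: measurable_cst|rewrite L2norm_dirac_cst ltry].
exists (bump_linear a c); first exact: test_function_bump_linear.
rewrite L2norm_dirac => [|i]; first by rewrite grad_bump_linear subrr enorm0 lte_fin.
under eq_fun do rewrite !mxE.
apply: measurable_funB; first exact: measurable_cst.
apply: continuous_measurable_from_rV; apply: smooth_continuous.
exact: (smooth_derive _ _ (smooth_bump_linear a c)).2.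
Qed.

Lemma tangent_projection_id nu (u : V -> V) :
  tangent nu u -> tangent_projection nu u u.
Proof.
move=> tu; split=> // xi _; rewrite [LHS](_ : _ = \int[nu]_x (cst 0) x).
  by rewrite Rintegral_cst// mul0r.
apply: eq_Rintegral => x _; rewrite subrr /dotp big1// => i _.
by rewrite mxE mul0r.
Qed.

Lemma supp_dirac a x : supp (diracP a) x <-> x = a.
Proof.
split=> [sx|-> U [oU Ua]]; last by rewrite /= diracE mem_set.
apply: contrapT => /eqP xa.
suff /sx : open_nbhs x (~` [set a]).
  by rewrite /= diracE memNset ?ltxx//; apply.
split; last exact/eqP.
apply: closed_openC; apply: compact_closed; last exact: compact_set1.
exact: norm_hausdorff.
Qed.

(** By the parallelogram identity the costs to [a] and [- a] add up to at least [2 |a|^2], so they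
    cannot both be smaller than [|a|^2]. *)
Lemma W2_two_points nu a :
  ((enorm a)%:E <= W2 nu (diracP a))%E \/ ((enorm a)%:E <= W2 nu (diracP (- a)))%E.
Proof.
pose I y := (\int[nu]_x (enorm (x - y) ^+ 2)%:E)%E.
have I_ge0 y : (0 <= I y)%E.
  by apply: integral_ge0 => x _; rewrite lee_fin sqr_ge0.
have mI y : measurable_fun setT (fun x => (enorm (x - y) ^+ 2)%:E).
  apply/measurable_EFinP; apply: measurable_rVB; first exact: measurable_id.
  exact: measurable_cst.
have W2_ge y : ((enorm a ^+ 2)%:E <= I y -> (enorm a)%:E <= W2 nu (diracP y))%E.
  move=> aI; apply: le_trans (W2_dirac_ge nu y).
  rewrite -[enorm a]ger0_norm ?sqrtr_ge0// -sqrtr_sqr.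
  rewrite [leLHS](_ : _ = sqrte (enorm a ^+ 2)%:E)//.
  by rewrite lee_sqrt; [exact: aI|exact: I_ge0].
have : ((enorm a ^+ 2)%:E + (enorm a ^+ 2)%:E <= I a + I (- a)%R)%E.
  rewrite /I -ge0_integralD//; last 2 first.
  - by move=> x _; rewrite lee_fin sqr_ge0.
  - by move=> x _; rewrite lee_fin sqr_ge0.
  (* As [nu] has mass 1, the constant becomes an integral and the integrands can be compared
     pointwise. *)
  rewrite -[leLHS]mule1 -(@probability_setT _ _ _ nu) -integral_cst//.
  apply: ge0_le_integral => //.
  - by move=> x _ /=; rewrite adde_ge0// lee_fin sqr_ge0.
  - by apply: emeasurable_funD; exact: mI.
  - move=> x _; rewrite -!EFinD lee_fin parallelogram mulr2n.
    by rewrite lerD// lerDr sqr_ge0.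
have [aI|aI] := leP (enorm a ^+ 2)%:E (I a).
  by left; exact: W2_ge.
have [aI'|aI'] := leP (enorm a ^+ 2)%:E (I (- a)%R).
  by right; exact: W2_ge.
by rewrite leNgt lteD.
Qed.

End Dirac_tangent.

(** * The extremal curves *)

Section Truncated_FTC.
Context {R : realType}.
Local Notation leb := (@lebesgue_measure R).
Variables (F f : R -> R).
Hypothesis dF : forall t, is_derive t (1 : R) F (f t).
Hypothesis cf : continuous f.

Lemma FTC2 s t : s <= t ->
  (\int[leb]_(r in `[s, t]) (f r)%:E = (F t - F s)%:E)%E.
Proof.
have cF : continuous F.
  by move=> x; apply: differentiable_continuous; apply/derivable1_diffP.
rewrite le_eqVlt => /predU1P[->|st].
  by rewrite set_itv1 integral_set1 subrr.
rewrite (@continuous_FTC2 _ f F)//.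
- exact: continuous_subspaceT.
- split; first by move=> x _.
    by apply: cvg_at_right_filter; exact: cF.
  by apply: cvg_at_left_filter; exact: cF.
- by move=> x _; rewrite derive1E derive_val.
Qed.

Variable tn : R.

Definition trunc (g : R -> R) (r : R) : R := if r <= tn then 0 else g r.

Lemma measurable_trunc : measurable_fun setT (trunc f).
Proof.
apply: measurable_fun_ifT => //.
- by apply: measurable_fun_ler; [exact: measurable_id|exact: measurable_cst].
- exact: continuous_measurable_fun.
Qed.

Lemma trunc_integrable s t : leb.-integrable `[s, t] (EFin \o trunc f).
Proof.
have : leb.-integrable `[s, t] (EFin \o f).
  apply: continuous_compact_integrable; first exact: segment_compact.
  exact: continuous_subspaceT.
apply: le_integrable => //.
  by apply/measurable_EFinP; apply: measurable_funTS; exact: measurable_trunc.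
by move=> r _ /=; rewrite lee_fin /trunc; case: ifP => //; rewrite normr0.
Qed.

(** Truncating the integrand restricts the interval to the times after [tn], which amounts to
    replacing both endpoints by their maximum with [tn]. *)
Lemma trunc_FTC s t : s <= t ->
  \int[leb]_(r in `[s, t]) trunc f r = F (Num.max t tn) - F (Num.max s tn).
Proof.
(* Left-open intervals are used because their intersection with []tn, +oo[] is again left-open,
   wherever [s] lies. *)
move=> st; rewrite /Rintegral -integral_itv_obnd_cbnd; last first.
  by apply/measurable_EFinP; apply: measurable_funTS; exact: measurable_trunc.
have -> : (fun r => (trunc f r)%:E) = (EFin \o f) \_ `]tn, +oo[.
  apply/funext => r; rewrite /trunc patchE mem_setE in_itv/= andbT.
  by case: leP.
rewrite -integral_mkcondr.
have -> : `]s, t] `&` `]tn, +oo[ = `]Num.max s tn, Num.max t tn]%classic.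
  apply/seteqP; split=> r /=; rewrite !in_itv/= andbT gt_max le_max.
    by move=> [/andP[-> ->] ->].
  by move=> /andP[/andP[-> tr]]; rewrite tr [r <= tn]leNgt tr orbF => ->.
rewrite integral_itv_obnd_cbnd; last first.
  apply/measurable_EFinP; apply: measurable_funTS.
  exact: continuous_measurable_fun.
by rewrite FTC2// ge_max !le_max st lexx orbT.
Qed.

End Truncated_FTC.

(** * Iterated primitives of a step function *)

Section Ramp.
Context {R : realType}.
Variables (tn eps : R).
Local Notation leb := (@lebesgue_measure R).

Definition monomial m t : R := eps * (t - tn) ^+ m / m`!%:R.

(* The [m]-th iterated primitive of [eps * 1_{t > tn}]; [eps] may be negative. *)
Definition ramp m : R -> R := trunc tn (monomial m).

Lemma is_derive_monomial m t :
  is_derive t (1 : R) (monomial m.+1) (monomial m t).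
Proof.
have dX : is_derive t 1 ((fun s : R => s - tn) ^+ m.+1)
    ((m.+1%:R * (t - tn) ^+ m) *: (1 - 0)).
  exact: is_deriveX.
have := is_deriveZ (eps / (m.+1)`!%:R) dX.
rewrite exprfctE /GRing.scale/= subr0 mulr1 => H.
rewrite (_ : monomial m.+1 =
    (fun x : R => eps / m.+1`!%:R * (x - tn) ^+ m.+1)); last first.
  by apply/funext => s; rewrite /monomial mulrAC.
apply: (is_derive_eq H).
rewrite /monomial factS natrM; field.
by rewrite nat1r !pnatr_eq0 -lt0n fact_gt0.
Qed.

Lemma continuous_monomial m : continuous (monomial m).
Proof.
case: m => [|m]; last first.
  move=> t; apply: differentiable_continuous; apply/derivable1_diffP.
  by have [] := is_derive_monomial m t.
rewrite (_ : monomial 0 = cst eps); first exact: cst_continuous.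
by apply/funext => t; rewrite /monomial expr0 mulr1 divr1.
Qed.

(** A monomial of positive degree vanishes at [tn], so truncating its value is the same as stopping
    its argument at [tn]. In degree 0 there is a jump instead. *)
Lemma rampS m t : ramp m.+1 t = monomial m.+1 (Num.max t tn).
Proof.
rewrite /ramp /trunc; case: leP => // _.
by rewrite /monomial subrr expr0n/= mulr0 mul0r.
Qed.

Lemma measurable_ramp m : measurable_fun setT (ramp m).
Proof. by apply: measurable_trunc; exact: continuous_monomial. Qed.

Lemma ramp_integrable m s t : leb.-integrable `[s, t] (EFin \o ramp m).
Proof. by apply: trunc_integrable; exact: continuous_monomial. Qed.

Lemma ramp_FTC m s t : s <= t ->
  \int[leb]_(r in `[s, t]) ramp m r = ramp m.+1 t - ramp m.+1 s.
Proof.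
move=> st; rewrite !rampS.
by rewrite (trunc_FTC _ _ (is_derive_monomial m) (@continuous_monomial m)).
Qed.

(** The ramp of order 1 may have a corner at [tn]; the chain rule is therefore applied to the
    untruncated monomial, and the product is truncated afterwards. *)
Lemma ramp_comp_FTC (psi dpsi : R -> R) m s t :
  (forall x, is_derive x (1 : R) psi (dpsi x)) -> continuous dpsi -> s <= t ->
  \int[leb]_(r in `[s, t]) (dpsi (ramp m.+1 r) * ramp m r) =
    psi (ramp m.+1 t) - psi (ramp m.+1 s).
Proof.
move=> dp cdp st; rewrite !rampS.
have D x : is_derive x (1 : R) (psi \o monomial m.+1)
    (dpsi (monomial m.+1 x) * monomial m x).
  have ? := is_derive_monomial m x; exact: is_derive1_comp.
have C : continuous (fun x => dpsi (monomial m.+1 x) * monomial m x).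
  move=> x; apply: cvgM; last exact: continuous_monomial.
  by apply: continuous_comp; [exact: continuous_monomial|exact: cdp].
rewrite -(trunc_FTC _ _ D C)//; apply: eq_Rintegral => r _.
rewrite /ramp /trunc; case: leP => // _.
by rewrite mulr0.
Qed.

Lemma ramp_ge0 m t : 0 <= eps -> 0 <= ramp m t.
Proof.
move=> e0; rewrite /ramp /trunc; case: (leP t tn) => // tnt.
by rewrite /monomial !mulr_ge0 ?invr_ge0 ?ler0n// exprn_ge0// subr_ge0 ltW.
Qed.

Lemma ramp_le m s t : 0 <= eps -> s <= t -> ramp m s <= ramp m t.
Proof.
move=> e0 st; rewrite /ramp /trunc; case: (leP s tn) => [_|tns].
  exact: ramp_ge0.
rewrite ifF; last by apply/negbTE; rewrite -ltNge (lt_le_trans tns).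
rewrite /monomial ler_wpM2r ?invr_ge0 ?ler0n// ler_wpM2l//.
by rewrite lerXn2r ?nnegrE ?lerB// subr_ge0 ltW// (lt_le_trans tns).
Qed.

(** The instant [tn], where the ramp of order 1 may have a corner, is left out; it is
    Lebesgue-null. *)
Lemma is_derive_ramp m t : t != tn -> is_derive t (1 : R) (ramp m.+1) (ramp m t).
Proof.
move=> ttn; rewrite /ramp /trunc; case: ltgtP ttn => // ttn _.
- apply: (@near_eq_is_derive _ _ _ (cst (0 : R))).
    near=> s; rewrite ifT// ltW//.
    by near: s; exact: lt_nbhsl.
- apply: (@near_eq_is_derive _ _ _ (monomial m.+1)); last exact: is_derive_monomial.
  near=> s; rewrite ifF//; apply/negbTE; rewrite -ltNge.
  by near: s; exact: lt_nbhsr.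
Unshelve. all: by end_near. Qed.

End Ramp.

Section Ramp_scaling.
Context {R : realType}.
Implicit Types (tn eps s t : R) (m : nat).
Local Notation leb := (@lebesgue_measure R).

(** Linearity in [eps] reduces signed ramps to the one with [eps = 1], which is nonnegative and
    nondecreasing. *)
Lemma ramp_scale tn eps m t : ramp tn eps m t = eps * ramp tn 1 m t.
Proof.
rewrite /ramp /trunc; case: leP => _; first by rewrite mulr0.
by rewrite /monomial mul1r mulrA.
Qed.

Lemma rampN tn eps m t : ramp tn (- eps) m t = - ramp tn eps m t.
Proof. by rewrite ramp_scale mulNr -ramp_scale. Qed.

Lemma normr_ramp tn eps m t : `|ramp tn eps m t| = ramp tn `|eps| m t.
Proof.
by rewrite ramp_scale normrM [`|ramp _ _ _ _|]ger0_norm ?ramp_ge0// -ramp_scale.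
Qed.

Lemma normr_rampB tn eps m s t : s <= t ->
  `|ramp tn eps m t - ramp tn eps m s| = ramp tn `|eps| m t - ramp tn `|eps| m s.
Proof.
move=> st; rewrite !(ramp_scale tn eps) !(ramp_scale tn `|eps|) -!mulrBr.
rewrite normrM.
by rewrite [`|_ - _|]ger0_norm// subr_ge0 ramp_le.
Qed.

Lemma integral_ramp tn eps m s t : s <= t ->
  (\int[leb]_(r in `[s, t]) (ramp tn eps m r)%:E =
   (ramp tn eps m.+1 t - ramp tn eps m.+1 s)%:E)%E.
Proof.
move=> st; rewrite -ramp_FTC// /Rintegral fineK//.
by apply: integrable_fin_num => //; exact: ramp_integrable.
Qed.

End Ramp_scaling.

(** * The moving Dirac mass, its velocity, flow and covariant derivatives *)

Section Ramp_curve.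
Context {R : realType} {d : nat}.
Variables (tn T eps : R) (i0 : 'I_d).
Local Notation V := 'rV[R]_d.
Local Notation leb := (@lebesgue_measure R).
Local Notation e0 := (delta_mx 0 i0 : V).

Definition ramp_vec m t : V := ramp tn eps m t *: e0.

Definition ramp_curve m t : P2 R d := diracP (ramp_vec m t).

Definition ramp_field m t (x : V) : V := ramp_vec m t.

(** The velocity is constant in space, so its flow is a translation. The index is that of the
    position: [ramp_flow m.+1] is the flow of [ramp_field m]. *)
Definition ramp_flow m t s (x : V) : V := x + (ramp_vec m s - ramp_vec m t).

Lemma enorm_ramp_vecB m s t : s <= t ->
  enorm (ramp_vec m t - ramp_vec m s) = ramp tn `|eps| m t - ramp tn `|eps| m s.
Proof. by move=> st; rewrite -scalerBl enorm_delta normr_rampB. Qed.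

Lemma L2norm_ramp_field a m t :
  L2norm (diracP a) (ramp_field m t) = `|ramp tn eps m t|%:E.
Proof. by rewrite L2norm_dirac_cst enorm_delta. Qed.

(** The speed [ramp tn |eps| m] serves as density: its integral over [[s, t]] is the length of the
    displacement. This covers both the curve in [W2] and the fields carried along the flow. *)
Lemma abs_cont_ramp (dist : R -> R -> \bar R) m :
  (forall s t, s <= t ->
    (dist s t <= (enorm (ramp_vec m.+1 t - ramp_vec m.+1 s))%:E)%E) ->
  abs_cont T dist.
Proof.
move=> distE; exists (ramp tn `|eps| m); split; first exact: ramp_integrable.
move=> s t _ st _; apply: (le_trans (distE _ _ st)).
by rewrite enorm_ramp_vecB// integral_ramp.
Qed.

Lemma ac_ramp_curve m : ac_curve T (ramp_curve m.+1).
Proof.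
apply: (@abs_cont_ramp _ m) => s t _; apply: le_trans (W2_dirac_le _ _) _.
by rewrite lee_fin -!scalerBl !enorm_delta distrC.
Qed.

Lemma borel_ramp_field m : borel_field (ramp_field m).
Proof.
rewrite /borel_field /ramp_field /ramp_vec.
apply: (@measurableT_comp _ _ _ _ _ _ (fun c : R => c *: e0)).
  apply: continuous_measurable_to_rV => c.
  exact: (cvgZr_tmp cvg_id).
by apply: measurableT_comp; [exact: measurable_ramp|exact: measurable_fst].
Qed.

(** Integrals against Dirac masses are evaluations, so the weak equation is the chain rule for
    [psi], the test function restricted to the axis of [e0], composed with the ramp. *)
Lemma ramp_continuity_equation m :
  continuity_equation T (ramp_curve m.+1) (ramp_field m).
Proof.
move=> phi [Cphi _] s t _ st _.
have cphi : continuous phi := Cphi 0%N.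
have [dphi cdphi] : (forall x, derivable phi x e0) /\
    continuous (fun x => 'D_e0 phi x).
  exact: (Cphi 1%N e0).
rewrite /Rintegral !integral_dirac_rV; try exact: continuous_measurable_from_rV.
rewrite /=.
pose psi y := phi (y *: e0); pose dpsi y := 'D_e0 phi (y *: e0).
have cl : continuous (fun y : R => y *: e0).
  by move=> y; exact: (cvgZr_tmp cvg_id).
have dpsiE y : is_derive y (1 : R) psi (dpsi y).
  have E : (fun h : R => h^-1 *: ((psi \o shift y) (h *: 1) - psi y)) =
      (fun h : R => h^-1 *: ((phi \o shift (y *: e0)) (h *: e0) - phi (y *: e0))).
    by apply/funext => h; rewrite /psi /= scalerDl [h *: 1]mulr1.
  apply: DeriveDef.
    by have := dphi (y *: e0); rewrite /derivable -E.
  by rewrite /dpsi /derive -E.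
have cdpsi : continuous dpsi.
  by move=> y; exact: (continuous_comp (cl y) (cdphi _)).
rewrite -/(psi _) -/(psi _) -(@ramp_comp_FTC _ _ _ psi dpsi)//.
congr fine; apply: eq_integral => r _; congr EFin.
have gE x : dotp (grad phi x) (ramp_field m r x) = ramp tn eps m r * 'D_e0 phi x.
  by rewrite dotp_delta mxE.
under eq_integral do rewrite gE.
rewrite integral_dirac_rV/=; first by rewrite mulrC.
apply: measurable_funM; first exact: measurable_cst.
exact: continuous_measurable_from_rV.
Qed.

Lemma ramp_velocity m : velocity T (ramp_curve m.+1) (ramp_field m).
Proof.
split.
- exact: borel_ramp_field.
- under eq_integral do rewrite L2norm_ramp_field.
  by have /integrableP[] := ramp_integrable tn eps m 0 T.
- by apply: aeW => t _; exact: tangent_dirac_cst.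
- exact: ramp_continuity_equation.
Qed.

Lemma ramp_regular m : regular_curve T (ramp_curve m.+1) (ramp_field m).
Proof.
split.
  under eq_integral do rewrite L2norm_ramp_field.
  (* The squared speed is the truncation of this continuous function, hence integrable. *)
  have c2 : continuous (fun t => monomial tn eps m t * monomial tn eps m t).
    by move=> t; apply: cvgM; exact: continuous_monomial.
  have /integrableP[_] := trunc_integrable _ c2 tn 0 T.
  apply: le_lt_trans; rewrite le_eqVlt; apply/orP; left; apply/eqP.
  apply: eq_integral => t _; rewrite -EFin_expe real_normK ?num_real// expr2.
  rewrite /= /ramp /trunc; case: (t <= tn); first by rewrite mul0r normr0.
  by rewrite ger0_norm// -expr2 sqr_ge0.
exists (cst 0); split.
  exact: integrable0.
by apply: aeW => t _ x y _ _; rewrite subrr enorm0 mul0r.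
Qed.

Lemma ramp_flow_flow m : flow T (ramp_curve m.+1) (ramp_field m) (ramp_flow m.+1).
Proof.
move=> t _; split.
- by move=> x _; rewrite /ramp_flow subrr addr0.
- by move=> s x _ /supp_dirac ->; apply/supp_dirac; rewrite /ramp_flow addrC subrK.
- move=> s _; apply: continuous_measurable_rV => x.
  exact: (cvgD cvg_id (cvg_cst _)).
- move=> x s1 s2 i _ _ s12 _.
  (* Each coordinate of the velocity is again a ramp, with [eps] multiplied by the matching
     coordinate of [e0]. *)
  have E : (fun r => (ramp_field m r (ramp_flow m.+1 t r x) 0 i)) =
           ramp tn (eps * e0 0 i) m.
    by apply/funext => r; rewrite mxE ramp_scale [in RHS]ramp_scale mulrAC.
  split.
    have := ramp_integrable tn (eps * e0 0 i) m s1 s2.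
    by rewrite -E.
  rewrite E ramp_FTC// !mxE ramp_scale [ramp tn eps m.+1 s1]ramp_scale.
  rewrite !(ramp_scale _ (eps * _)); ring.
Qed.

Lemma ac_ramp_field n m : ac_field T (ramp_curve n) (ramp_flow n) (ramp_field m.+1).
Proof.
split.
- exact: borel_ramp_field.
- by move=> t _; rewrite L2norm_ramp_field ltry.
- move=> t0 _; apply: (@abs_cont_ramp _ m) => s t _.
  by rewrite /ramp_curve /ramp_field L2norm_dirac_cst.
Qed.

(** For a field constant in space the flow has no effect, and the statement reduces to the scalar
    derivative of the ramp. *)
Lemma ramp_total_derivative n m t : t != tn ->
  total_derivative (ramp_curve n) (ramp_flow n) (ramp_field m.+1) t (ramp_field m t).
Proof.
move=> ttn; split.
  by split; [exact: measurable_cst|rewrite L2norm_ramp_field ltry].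
have [D DE] := is_derive_ramp tn eps m t ttn.
have E s : L2norm (ramp_curve n t) (fun x => s^-1 *:
     (ramp_field m.+1 (t + s) (ramp_flow n t (t + s) x) -
      ramp_field m.+1 t x) - ramp_field m t x) =
   `|s^-1 * (ramp tn eps m.+1 (t + s) - ramp tn eps m.+1 t) - ramp tn eps m t|%:E.
  rewrite /ramp_curve /ramp_field L2norm_dirac_cst.
  by rewrite -!scalerBl scalerA -scalerBl enorm_delta.
under eq_cvg do rewrite E.
apply: cvg_EFin; first exact: nearW.
have C : s^-1 * (ramp tn eps m.+1 (t + s) - ramp tn eps m.+1 t)
    @[s --> (0 : R)^'] --> ramp tn eps m t.
  rewrite -DE (_ : (fun s : R => _) = (fun s : R => s^-1 *:
      ((ramp tn eps m.+1 \o shift t) (s *: 1) - ramp tn eps m.+1 t)))//.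
  by apply/funext => s; rewrite /= [s *: 1]mulr1 [t + s]addrC.
have := cvg_norm (cvgB C (cvg_cst (ramp tn eps m t))).
by rewrite subrr normr0; apply.
Qed.

(** Here [n] indexes the curve and [m] the field. The total derivative is constant in space, hence
    tangent and equal to its own projection. *)
Lemma ramp_covariant_derivative n m :
  covariant_derivative T (ramp_curve n.+1) (ramp_field n)
    (ramp_field m.+1) (ramp_field m).
Proof.
split; first exact: ramp_regular.
exists (ramp_flow n.+1), (ramp_field m); split.
- exact: ramp_flow_flow.
- exact: ac_ramp_field.
- by apply: aeW => t _; exact: tangent_dirac_cst.
- exact: borel_ramp_field.
(* The only exceptional time is [tn]. *)
- exists [set tn]; split => //.
    by apply: countable_lebesgue_measure0; exact: countable1.
  move=> t /= H; apply: contrapT => /eqP ttn; apply: H => _; split.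
    exact: ramp_total_derivative.
  exact/tangent_projection_id/tangent_dirac_cst.
Qed.

(** Each covariant derivative lowers the degree by one: the velocity has degree [k] and its [k]-th
    derivative degree 0, that is [eps] after [tn] and 0 before. *)
Lemma Ck_ramp k : Ck T k `|eps| (ramp_curve k.+1).
Proof.
split; first exact: ac_ramp_curve.
exists (fun j => ramp_field (k - j)); split.
- by rewrite subn0; exact: ramp_velocity.
- move=> j jk; rewrite subn0 -(subnSK jk); exact: ramp_covariant_derivative.
- apply/ess_supP; apply: aeW => t; rewrite patchE; case: ifPn => _; last first.
    by rewrite lee_fin.
  rewrite subnn L2norm_ramp_field lee_fin normr_ramp /ramp /trunc.
  case: (t <= tn) => //.
  by rewrite /monomial expr0 mulr1 divr1.
Qed.

End Ramp_curve.

(** * The minimax lower bound *)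

Theorem theorem1 (R : realType) (d : nat) (tn T h eps : R) (k : nat)
  (hd : (0 < d)%N) (htn : 0 <= tn) (hh : 0 < h) (hT : tn + h <= T)
  (heps : 0 < eps) :
  ((eps * h ^+ k.+1 / (k.+1)`!%:R)%:E <=
   ereal_inf
     [set ereal_sup
        [set W2 (nu (past tn mu)) (mu (tn + h)%R) | mu in Ck (d := d) T k eps]
     | nu in forecaster (d := d) tn])%E.
Proof.
apply/ereal_infP => _ [nu _ <-].
pose i0 := Ordinal hd.
pose mu a := ramp_curve (R := R) tn a i0 k.+1.
(* Every amplitude [a] gives the Dirac mass at the origin up to [tn], so the forecast does not
   depend on [a]. *)
have pastE a : past tn (mu a) = past tn (mu eps).
  apply/funext => -[t tP]; have /andP[_ ttn] := tP.
  rewrite /past /mu /ramp_curve /=.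
  by rewrite /ramp_vec /ramp /trunc ttn.
have Ckmu a : `|a| = eps -> Ck (d := d) T k eps (mu a).
  by move=> <-; exact: Ck_ramp.
have rampE a : ramp tn a k.+1 (tn + h) = a * h ^+ k.+1 / k.+1`!%:R.
  by rewrite /ramp /trunc leNgt ltrDl hh/= /monomial addrAC subrr add0r.
have le_sup a : `|a| = eps -> (W2 (nu (past tn (mu eps))) (mu a (tn + h)%R) <=
    ereal_sup [set W2 (nu (past tn mu)) (mu (tn + h)%R) | mu in Ck T k eps])%E.
  by move=> aE; apply: ereal_sup_ubound; exists (mu a); [exact: Ckmu|rewrite pastE].
have normE : enorm (ramp_vec tn eps i0 k.+1 (tn + h)) = eps * h ^+ k.+1 / k.+1`!%:R.
  rewrite enorm_delta rampE ger0_norm// !mulr_ge0 ?invr_ge0 ?ler0n ?(ltW heps)//.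
  by rewrite exprn_ge0 ?(ltW hh).
have [] := W2_two_points (nu (past tn (mu eps))) (ramp_vec tn eps i0 k.+1 (tn + h)).
  rewrite normE => /le_trans; apply; apply: le_sup.
  by rewrite gtr0_norm.
rewrite normE => /le_trans; apply.
(* The opposite point is the position of the curve of amplitude [- eps], which lies in the same
   class. *)
rewrite -scaleNr -rampN; apply: (le_sup (- eps)).
by rewrite normrN gtr0_norm.
Qed.
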